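(* Let $r$ be a positive integer or $r=\infty$. For each $n\ge0$, $$G^\vee_r(z)h_n=\sum_{i\ge0}\frac{h_{n-i}}{z^i}=h_n+\frac{h_{n-1}}{z}+\cdots+\frac{h_1}{z^{n-1}}+\frac{1}{z^n}.$$
   Context: Let $r\in\{1,2,3,\dots\}\cup\{\infty\}$. $B_r=\mathbb{Q}[e_i : i\in\mathbb{N},\ 1\le i\le r]$ is a polynomial ring; $e_0=1$ and $e_i=0$ for $i>r$. $E_r(t)=1+\sum_{1\le i\le r}(-1)^ie_it^i\in B_r[[t]]$, and $H_r=(h_n)_{n\in\mathbb{Z}}$ is defined by $\sum_{n\in\mathbb{Z}}h_nt^n=1/E_r(t)$ (so $h_n=0$ for $n<0$, $h_0=1$). $\mathcal{P}_r$ is the set of partitions $\boldsymbol{\lambda}=(\lambda_1\ge\lambda_2\ge\cdots)$ with at most $r$ nonzero parts (all partitions if $r=\infty$). $\Delta_{\boldsymbol{\lambda}}(H_r)=\det(h_{\lambda_j-j+i})_{1\le i,j\le k}$, where $k=r$ if $r<\infty$ and $k$ is any integer at least the length of $\boldsymbol{\lambda}$ if $r=\infty$ (the value does not depend on $k$). It is known that $(\Delta_{\boldsymbol{\lambda}}(H_r))_{\boldsymbol{\lambda}\in\mathcal{P}_r}$ is a $\mathbb{Q}$-basis of $B_r$; for $n\ge0$, $h_n=\Delta_{(n)}(H_r)$. For $j\in\mathbb{Z}$ let $u_j=\sum_{n\ge0}h_{n+j}\frac{t^n}{n!}\in B_r[[t]]$ (linearly independent over $\mathbb{Q}$). Semi-infinite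 exterior monomials $u_{i_0}\wedge u_{i_1}\wedge\cdots$ (with $i_{m+1}=i_m-1$ for all large $m$) are formal symbols over $\mathbb{Q}$, alternating in their entries. Put $\Phi^r_{i,\boldsymbol{\lambda}}=u_{i+\lambda_1}\wedge u_{i-1+\lambda_2}\wedge u_{i-2+\lambda_3}\wedge\cdots$ (with $\lambda_m=0$ beyond the length of $\boldsymbol{\lambda}$), $\Phi^r_0=\Phi^r_{0,(0)}$. Contraction with the dual vector $u_i^\vee$ ($u_i^\vee(u_j)=\delta_{ij}$) is $u_i^\vee\lrcorner(u_{i_0}\wedge u_{i_1}\wedge\cdots)=\sum_{m\ge0}(-1)^m\delta_{i,i_m}\,u_{i_0}\wedge\cdots\wedge\widehat{u_{i_m}}\wedge\cdots$ (hat means omitted). For $\phi=\sum_{n\ge0}a_n\frac{t^n}{n!}\in B_r[[t]]$ and $k\in\mathbb{N}$ let $U_k(\phi)=a_k+\sum_{i\ge1}(-1)^ie_ia_{k-i}$, where $a_j=0$ for $j<0$; then $\phi=\sum_{i\ge0}U_i(\phi)u_{-i}$. For a monomial $\alpha=u_{i_0}\wedge u_{i_1}\wedge\cdots$ with $i_m=-m$ for all $m\ge k$, put $[\alpha]=(\alpha\otimes_{\mathbb{Q}}1_{B_r})/\Phi^r_0=\det\big(U_a(u_{i_b})\big)_{0\le a,b\le k-1}\in B_r$ (independent of $k$; this is the result of expanding each $u_{i_b}$ $B_r$-linearly in the $u_{-a}$, $a\ge0$). Extend $[\cdot]$ $\mathbb{Q}$-linearly. The vertex operator $\Gamma^\vee_r(z)$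 is the $\mathbb{Q}$-linear map on $B_r$ with $\Gamma^\vee_r(z)\Delta_{\boldsymbol{\lambda}}(H_r)=\sum_{i\in\mathbb{Z}}[u_i^\vee\lrcorner\Phi^r_{1,\boldsymbol{\lambda}}]\,z^{-i}$ for $\boldsymbol{\lambda}\in\mathcal{P}_r$. Only finitely many negative powers of $z$ occur, so the values lie in $B_r((z))$. $G^\vee_r(z)$ is the $\mathbb{Q}$-linear map with $G^\vee_r(z)\Delta_{\boldsymbol{\lambda}}(H_r)=\big(z\,\Gamma^\vee_r(z)\Delta_{\boldsymbol{\lambda}}(H_r)\big)/E_r(z)$. *)

(* Defs.v *)
From HB Require Import structures.
From mathcomp Require Import all_boot all_order all_algebra finmap.
From mathcomp Require Import zify.
From mathcomp Require Import boolp classical_sets functions cardinality fsbigop.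
From mathcomp.multinomials Require Import monalg.

Set Implicit Arguments.
Unset Strict Implicit.
Unset Printing Implicit Defensive.

Import Order.TTheory GRing.Theory Num.Theory.

Local Open Scope ring_scope.

(* The rank r is an [option nat], [None] standing for r = oo. *)
Definition le_rank (n : nat) (r : option nat) : bool :=
  if r is Some k then (n <= k)%N else true.

Definition idx (r : option nat) : Type := {i : nat | (1 <= i)%N && le_rank i r}.
HB.instance Definition _ r := Choice.on (idx r).

(* B_r = Q[e_i : 1 <= i <= r], as the monoid algebra over Q of the free
   commutative monoid on the index set (possibly infinite). *)
Notation Br r := {malg rat[{cmonom (idx r)}]}.

Definition e_ (r : option nat) (i : nat) : Br r :=
  if i == 0%N then 1 else
  if insub i is Some x then << ucm (x : idx r) >> else 0.

(* Formal power series are given by their coefficient sequences. *)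
Section PowerSeries.
Variable R : comNzRingType.

Definition psmul (f g : nat -> R) (n : nat) : R :=
  \sum_(k < n.+1) f k * g (n - k)%N.

(* Inverse of a series f with f 0 = 1: the coefficients 0, ..., n, from
   g_(n+1) = - \sum_(1 <= k <= n+1) f_k g_(n+1-k). *)
Fixpoint psinv_seq (f : nat -> R) (n : nat) : seq R :=
  if n is n'.+1 then
    let s := psinv_seq f n' in
    rcons s (- \sum_(k < n'.+1) f k.+1 * s`_(n' - k))
  else [:: 1].

Definition psinv (f : nat -> R) (n : nat) : R := (psinv_seq f n)`_n.

Lemma size_psinv_seq f n : size (psinv_seq f n) = n.+1.
Proof. by elim: n => //= n IH; rewrite size_rcons IH. Qed.

Lemma nth_psinv_seq f n k : (k <= n)%N -> (psinv_seq f n)`_k = psinv f k.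
Proof.
elim: n => [|n IH]; first by case: k.
rewrite leq_eqVlt => /orP[/eqP -> //|lt_kn].
by rewrite /= nth_rcons size_psinv_seq lt_kn IH.
Qed.

Lemma psmulV f : f 0%N = 1 -> psmul f (psinv f) = fun n => (n == 0%N)%:R.
Proof.
move=> f0; apply/funext => -[|n]; rewrite /psmul big_ord_recl f0 mul1r ?big_ord0.
  by rewrite addr0.
rewrite subn0 {1}/psinv /= nth_rcons size_psinv_seq ltnn eqxx.
rewrite addrC; apply/eqP; rewrite subr_eq0; apply/eqP; apply: eq_bigr => k _.
by rewrite subSS nth_psinv_seq ?leq_subr.
Qed.

End PowerSeries.

Definition E_ (r : option nat) (i : nat) : Br r := (-1) ^+ i * e_ r i.

Definition h_ (r : option nat) (n : int) : Br r :=
  if n is Posz m then psinv (E_ r) m else 0.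

(* A partition is the list of its nonzero parts. *)
Definition is_partition (r : option nat) (s : seq nat) : bool :=
  [&& sorted geq s, all (leq 1) s & le_rank (size s) r].

Definition partition_ (r : option nat) : Type := {s : seq nat | is_partition r s}.

(* [part l m] is lambda_(m+1). *)
Definition part (r : option nat) (l : partition_ r) (m : nat) : nat :=
  nth 0%N (val l) m.

Definition part_length (r : option nat) (l : partition_ r) : nat := size (val l).

Definition Delta (r : option nat) (l : partition_ r) : Br r :=
  let k := if r is Some n then n else part_length l in
  \det (\matrix_(i < k, j < k)
          h_ r ((part l j)%:Z - (j : nat)%:Z + (i : nat)%:Z)).

(* Monomials u_{s 0} /\ u_{s 1} /\ ... *)
Definition is_semimon (s : nat -> int) : Prop :=
  (forall m, s m.+1 < s m) /\
  exists N, forall m, (N <= m)%N -> s m.+1 = s m - 1.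

Definition semimon : Type := {s : nat -> int | `[< is_semimon s >]}.
HB.instance Definition _ := Choice.on semimon.

(* The space of alternating semi-infinite monomials over Q is free on the
   strictly decreasing ones; contraction does not leave this basis, and no
   other monomial occurs below. *)
Notation semiwedge := {malg rat[semimon]}.

Definition linext (r : option nat) (f : semimon -> Br r) (x : semiwedge) : Br r :=
  \sum_(a <- msupp x) x@_a *: f a.

Definition Phi_seq (r : option nat) (c : int) (l : partition_ r) (m : nat) : int :=
  c - m%:Z + (part l m)%:Z.

Lemma part_le r (l : partition_ r) m : (part l m.+1 <= part l m)%N.
Proof.
rewrite /part; case: l => s /= /and3P[s_sorted _ _].
have [lt_ms|le_sm] := ltnP m.+1 (size s); last by rewrite nth_default.
by have := sortedP 0%N s_sorted; apply.
Qed.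

Lemma Phi_subproof r c (l : partition_ r) : `[< is_semimon (Phi_seq c l) >].
Proof.
apply/asboolP; split=> [m|]; first by have := part_le l m; rewrite /Phi_seq; lia.
exists (part_length l) => m lem; rewrite /Phi_seq /part !nth_default ?(leqW lem) //;
  by lia.
Qed.

Definition Phi (r : option nat) (c : int) (l : partition_ r) : semimon :=
  exist _ (Phi_seq c l) (Phi_subproof c l).

Definition omit_seq (m : nat) (s : nat -> int) (j : nat) : int := s (bump m j).

Lemma omit_subproof m (a : semimon) : `[< is_semimon (omit_seq m (val a)) >].
Proof.
case: a => s /= /asboolP[s_decr [N sN]]; apply/asboolP; split=> [j|].
  rewrite /omit_seq /bump; case: (leqP m j) => mj.
    by rewrite (leqW mj) !add1n.
  rewrite add0n; case: leqP => _; last by rewrite add0n.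
  by rewrite add1n; apply: lt_trans (s_decr j); apply: s_decr.
exists (maxn m N) => j; rewrite geq_max /omit_seq /bump => /andP[mj Nj].
by rewrite mj (leqW mj) !add1n sN // leqW.
Qed.

Definition omit (m : nat) (a : semimon) : semimon :=
  exist _ (omit_seq m (val a)) (omit_subproof m a).

Definition contract (i : int) (a : semimon) : semiwedge :=
  \sum_(m \in [set: nat]) ((-1) ^+ m * (i == val a m)%:R : rat) *: << omit m a >>.

(* u_j, as the sequence of its coefficients on the t^n. *)
Definition u_ (r : option nat) (j : int) (n : nat) : Br r :=
  (n`!%:R)^-1 *: h_ r (n%:Z + j).

(* U_k(phi), for phi given by its coefficients on the t^n; the a_n are the
   coefficients of phi on the t^n / n!. *)
Definition U_ (r : option nat) (k : nat) (phi : nat -> Br r) : Br r :=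
  let a n := n`!%:R *: phi n in
  a k + \sum_(1 <= i < k.+1) (-1) ^+ i * e_ r i * a (k - i)%N.

(* [bracket r a] is independent of the k picked; the value 0 when there is no
   such k (which means that a has a charge other than that of Phi_0) is junk. *)
Definition bracket_mon (r : option nat) (a : semimon) : Br r :=
  let P : set nat := [set k | forall m, (k <= m)%N -> val a m = - m%:Z]%classic in
  if `[< exists k, P k >] then
    let k := xget 0%N P in
    \det (\matrix_(i < k, j < k) U_ i (u_ r (val a j)))
  else 0.

Definition bracket (r : option nat) : semiwedge -> Br r :=
  linext (@bracket_mon r).

(* Doubly infinite series \sum_m f_m z^m are functions f : int -> B_r; those
   in B_r((z)) vanish at all small enough m. *)
Definition zpow (r : option nat) (d : int) (m : int) : Br r := (m == d)%:R.

Definition zmul (r : option nat) (f : int -> Br r) (m : int) : Br r := f (m - 1).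

(* Product of a Laurent series and a power series: the sum over k is finite
   for f in B_r((z)). *)
Definition lmul (r : option nat) (f : int -> Br r) (g : nat -> Br r) (m : int) :
    Br r :=
  \sum_(k \in [set: nat]) f (m - k%:Z) * g k.

(* The coefficient of z^m in Gamma(Delta_l) is that of index i = -m. *)
Definition is_GammaV (r : option nat) (Gamma : {linear Br r -> (int -> Br r)}) :
    Prop :=
  forall l : partition_ r,
    Gamma (Delta l) = fun m : int => bracket r (contract (- m) (Phi 1 l)).

Definition is_GV (r : option nat) (Gamma G : {linear Br r -> (int -> Br r)}) :
    Prop :=
  forall l : partition_ r,
    G (Delta l) = lmul (zmul (Gamma (Delta l))) (psinv (E_ r)).

(* Main.v *)
Require Import Defs.
From mathcomp Require Import all_boot all_order all_algebra finmap.
From mathcomp Require Import zify.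
From mathcomp Require Import boolp classical_sets functions cardinality fsbigop.
From mathcomp.multinomials Require Import monalg.

(** In Phi_(1,(n)) = u_(n+1) /\ u_0 /\ u_(-1) /\ ..., contracting away u_(n+1)
    leaves Phi_0, while contracting away u_(-j) leaves a monomial whose bracket
    is, up to sign, the coordinate U_j(u_(n+1)): its matrix is the identity with
    one column moved. Hence
    Gamma h_n = z^(-n-1) - \sum_(j >= 0) U_j(u_(n+1)) z^j, and
    \sum_j U_j(u_(n+1)) z^j = E(z) \sum_j h_(n+1+j) z^j. Multiplying by z / E(z)
    gives z^(-n) \sum_k h_k z^k minus its part in positive powers of z. *)

Set Implicit Arguments.
Unset Strict Implicit.
Unset Printing Implicit Defensive.

Import Order.TTheory GRing.Theory Num.Theory.

Local Open Scope ring_scope.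

(** * Ring laws for products of power series *)

Section PowerSeries.
Variable R : comNzRingType.
Implicit Types f g h : nat -> R.

(** The coefficient of degree [n] only sees degrees up to [n], so ring laws can be imported from
    truncated polynomials. *)
Lemma psmul_poly N f g n : (n < N)%N ->
  psmul f g n = ((\poly_(i < N) f i) * (\poly_(i < N) g i))`_n.
Proof.
move=> nN; rewrite /psmul coefM; apply: eq_bigr => i _; rewrite !coef_poly.
by rewrite !ifT //; case: i => i /=; lia.
Qed.

Lemma psmulC f g : psmul f g = psmul g f.
Proof. by apply/funext => n; rewrite !(@psmul_poly n.+1) // mulrC. Qed.

Lemma psmulA f g h : psmul f (psmul g h) = psmul (psmul f g) h.
Proof.
apply/funext => n.
have lt_poly (p : nat -> R) N k : (k < N)%N -> (\poly_(i < N) p i)`_k = p k.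
  by rewrite coef_poly => ->.
transitivity (((\poly_(i < n.+1) f i)
    * ((\poly_(i < n.+1) g i) * (\poly_(i < n.+1) h i)))`_n).
  rewrite coefM; apply: eq_bigr => -[i /= lt_in] _.
  by rewrite lt_poly // -psmul_poly //; lia.
rewrite mulrA coefM; apply: eq_bigr => -[i /= lt_in] _.
by rewrite lt_poly -?psmul_poly //; lia.
Qed.

Lemma psmul1 f : psmul (fun n => (n == 0%N)%:R) f = f.
Proof.
apply/funext => n; rewrite /psmul big_ord_recl mul1r subn0 big1 ?addr0 // => i _.
by rewrite mul0r.
Qed.

End PowerSeries.

Lemma fsum_ord (V : zmodType) (n : nat) (F : nat -> V) :
  (forall k, (n <= k)%N -> F k = 0) ->
  \sum_(k \in [set: nat]) F k = \sum_(k < n) F k.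
Proof.
move=> F0; rewrite fsbig_ord; apply/esym/fsbig_widen => // k [_ /= /negP].
by rewrite -leqNgt => /F0.
Qed.

Lemma fsum_single (V : zmodType) (n : nat) (F : nat -> V) :
  (forall k, k != n -> F k = 0) -> \sum_(k \in [set: nat]) F k = F n.
Proof.
move=> F0; rewrite (@fsum_ord _ n.+1) => [|k lt_nk]; last by apply: F0; lia.
by rewrite big_ord_recr /= big1 ?add0r // => -[k /= lt_kn] _; apply: F0; lia.
Qed.

(** * Contraction of strictly decreasing monomials *)

Lemma semimon_lt (a : semimon) (m n : nat) : (m < n)%N -> val a n < val a m.
Proof.
case: a => s /= /asboolP[s_decr _]; elim: n => // n IH.
rewrite ltnS leq_eqVlt => /predU1P[->|/IH]; first exact: s_decr.
exact: lt_trans.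
Qed.

Lemma contract_val (a : semimon) (m : nat) :
  contract (val a m) a = (-1) ^+ m *: << omit m a >>.
Proof.
rewrite /contract (@fsum_single _ m) => [|k]; first by rewrite eqxx mulr1.
by rewrite neq_ltn => /orP[] /(semimon_lt a);
  rewrite lt_neqAle => /andP[/negPf + _]; rewrite 1?eq_sym => ->;
  rewrite mulr0 scale0r.
Qed.

Lemma contract_out (a : semimon) (i : int) :
  (forall m, val a m != i) -> contract i a = 0.
Proof.
move=> a_i; apply: fsbig1 => m _.
by rewrite eq_sym (negPf (a_i m)) mulr0 scale0r.
Qed.

(** Row [j] vanishes outside column 0, since the other columns are the standard basis vectors with
    index [j] skipped. Deleting this row and column 0 leaves the identity. *)
Lemma det_cycle (R : comNzRingType) (k j : nat) (v : nat -> R) : (j < k)%N ->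
  \det (\matrix_(a < k, b < k)
      if (b : nat) is b'.+1 then ((a : nat) == (if b' < j then b' else b)%N)%:R
      else v a) = (-1) ^+ j * v j.
Proof.
case: k => // k lt_jk; set M := (X in \det X).
rewrite (expand_det_row M (Ordinal lt_jk)) (bigD1 ord0) //=.
rewrite big1 => [|[[|b] lt_bk] //= _].
  rewrite /cofactor addr0 mxE /= addn0 (_ : row' _ _ = 1%:M) ?det1 ?mulr1 1?mulrC //.
  apply/matrixP => a b; rewrite !mxE /= /bump leq0n add1n add0n.
  by congr ((_ : bool)%:R); rewrite -val_eqE /=; case: leqP; case: leqP; lia.
by rewrite mxE /= (_ : (j == _) = false) ?mul0r //; case: ltnP; lia.
Qed.

(** * Brackets and the coordinates [U_] *)

Section FixedRank.
Variable r : option nat.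

Local Notation H := (psinv (E_ r)).

Lemma bracket0 : bracket r 0 = 0.
Proof. by rewrite /bracket /linext msupp0 big_seq_fset0. Qed.

Lemma bracket_monom (c : rat) (a : semimon) :
  bracket r (c *: << a >>) = c *: bracket_mon r a.
Proof.
rewrite /bracket /linext msuppZ msuppU oner_eq0; case: eqP => [->|_].
  by rewrite big_seq_fset0 scale0r.
by rewrite big_seq_fset1 mcoeffZ mcoeffUU mulr1.
Qed.

(** [xget] picks an unspecified admissible [k], so the determinant has to be known for all of
    them. *)
Lemma bracket_mon_det (a : semimon) (v : Br r) :
    (exists k, forall m, (k <= m)%N -> val a m = - m%:Z) ->
    (forall k, (forall m, (k <= m)%N -> val a m = - m%:Z) ->
       \det (\matrix_(i < k, j < k) U_ i (u_ r (val a j))) = v) ->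
  bracket_mon r a = v.
Proof.
move=> exk detv; rewrite /bracket_mon; case: asboolP => // {}exk.
exact/detv/(xgetPex 0%N exk).
Qed.

Lemma E_0 : E_ r 0 = 1.
Proof. by rewrite /E_ /e_ eqxx mulr1. Qed.

(** The factorials in [u_] and [U_] cancel, which turns [U_] into a coefficient of a product with
    E(t). *)
Lemma U_u k (c : int) :
  U_ k (u_ r c) = psmul (E_ r) (fun n => h_ r (n%:Z + c)) k.
Proof.
have aE n : n`!%:R *: u_ r c n = h_ r (n%:Z + c).
  by rewrite scalerA mulfV ?scale1r // pnatr_eq0 -lt0n fact_gt0.
pose F (b : nat -> Br r) :=
  b k + \sum_(1 <= i < k.+1) (-1) ^+ i * e_ r i * b (k - i)%N.
rewrite -[LHS]/(F (fun n => n`!%:R *: u_ r c n)) (funext aE) /F.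
by rewrite /psmul big_ord_recl E_0 mul1r subn0 big_add1 big_mkord.
Qed.

(** The coefficients h_(n-d) form the series t^d / E(t), and multiplying by E(t) leaves t^d. *)
Lemma U_u_opp k (d : nat) : U_ k (u_ r (- d%:Z)) = (k == d)%:R.
Proof.
have -> : (k == d)%:R = psmul (E_ r) (psmul (fun n => (n == d)%:R) H) k :> Br r.
  by rewrite psmulA [psmul (E_ r) _]psmulC -psmulA psmulV ?E_0 // psmulC psmul1.
rewrite U_u; congr (psmul _ _ k); apply/funext => n; rewrite /psmul.
have [le_dn|lt_nd] := leqP d n.
  rewrite subzn //= (bigD1 (Ordinal (le_dn : (d < n.+1)%N))) //= eqxx mul1r.
  by rewrite big1 ?addr0 // => i /negPf; rewrite -val_eqE /= => ->; rewrite mul0r.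
rewrite big1 => [|[i /= lt_in] _]; last by rewrite ltn_eqF ?mul0r //; lia.
by case E: (n%:Z - d%:Z) => //; lia.
Qed.

(** * One-row partitions *)

Hypothesis r_ge1 : le_rank 1 r.

(** Listed parts are nonzero, so the partition (0) is the empty list; [r_ge1] leaves room for one
    part when [n] is positive. *)
Lemma row_subproof n : is_partition r (if n is 0 then [::] else [:: n]).
Proof. by case: n => [|n] //; rewrite /is_partition /= /le_rank; case: r. Qed.

Definition row_partition n : partition_ r :=
  exist (fun s => is_partition r s) _ (row_subproof n).

Lemma part_row n m : part (row_partition n) m = if m is 0 then n else 0%N.
Proof. by rewrite /part /=; case: n => [|n]; case: m => [|m] //=; case: m. Qed.

(** Every column but the first comes from a zero part, so the matrix is lower triangular with
    diagonal h_n, 1, ..., 1. *)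
Lemma Delta_row n : Delta (row_partition n) = h_ r n%:Z.
Proof.
(* The side condition lets in the empty matrix, met for infinite rank and [n = 0], where both sides
   are 1. *)
have det_row k : (k = 0 -> n = 0)%N -> \det (\matrix_(i < k, j < k)
    h_ r ((part (row_partition n) j)%:Z - (j : nat)%:Z + (i : nat)%:Z)) = h_ r n%:Z.
  case: k => [/(_ erefl) ->|k _]; first by rewrite det_mx00.
  rewrite det_trig => [|].
    rewrite big_ord_recl big1 => [|i _]; rewrite !mxE part_row /=.
      by rewrite mulr1 !addn0.
    by rewrite [X in h_ r X](_ : _ = 0) //; lia.
  apply/is_trig_mxP => i j lt_ij; rewrite mxE part_row.
  by case: (j : nat) lt_ij => // j' lt_ij; rewrite /h_; case E: (_ + _) => //; lia.
apply: det_row; rewrite (_ : part_length _ = (0 < n)%N) => [|].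
  by move: r_ge1; case: (r) => [k|] /=; lia.
by rewrite /part_length /=; case: (n).
Qed.

Lemma Phi_row n m :
  val (Phi 1 (row_partition n)) m = if m is m'.+1 then - m'%:Z else n.+1%:Z.
Proof. by rewrite /= /Phi_seq part_row; case: m => [|m]; lia. Qed.

Lemma bracket_mon_omit0 n : bracket_mon r (omit 0 (Phi 1 (row_partition n))) = 1.
Proof.
have omitE m : val (omit 0 (Phi 1 (row_partition n))) m = - m%:Z.
  exact: (Phi_row n m.+1).
apply: bracket_mon_det => [|k _]; first by exists 0%N.
rewrite (_ : \matrix_(_, _) _ = 1%:M) ?det1 //.
by apply/matrixP => a b; rewrite !mxE omitE U_u_opp.
Qed.

Lemma bracket_mon_omitS n j :
  bracket_mon r (omit j.+1 (Phi 1 (row_partition n)))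
    = (-1) ^+ j * U_ j (u_ r n.+1%:Z).
Proof.
have omitE m : val (omit j.+1 (Phi 1 (row_partition n))) m =
    if m is m'.+1 then - (if m' < j then m' else m)%N%:Z else n.+1%:Z.
  transitivity (val (Phi 1 (row_partition n)) (bump j.+1 m)) => //.
  rewrite Phi_row /bump.
  by case: m => [|m] //; rewrite ltnS; case: leqP.
apply: bracket_mon_det => [|k omit_k].
  by exists j.+1 => -[|m] // lt_jm; rewrite omitE ltnNge -ltnS lt_jm.
(* An admissible [k] exceeds [j]: the entry at position [j] is [n + 1] if [j = 0] and [- (j - 1)]
   otherwise, never [- j]. *)
have lt_jk : (j < k)%N.
  by rewrite ltnNge; apply/negP => /omit_k; rewrite omitE; case: (j) => [|i]; rewrite ?ltnSn; lia.
rewrite -[RHS](det_cycle (fun i => U_ i (u_ r n.+1%:Z)) lt_jk); congr (\det _); apply/matrixP => a b.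
by rewrite !mxE omitE; case: (b : nat) => [|b'] //; rewrite U_u_opp.
Qed.

Lemma bracket_contract_row n (m : int) :
  bracket r (contract (- m) (Phi 1 (row_partition n))) =
    (m == - n.+1%:Z)%:R - (if m is Posz j then U_ j (u_ r n.+1%:Z) else 0).
Proof.
have contractE i j : i = val (Phi 1 (row_partition n)) j ->
    bracket r (contract i (Phi 1 (row_partition n)))
      = (-1) ^+ j *: bracket_mon r (omit j (Phi 1 (row_partition n))).
  by move=> ->; rewrite contract_val bracket_monom.
case: m => j.
  (* u_(-j) sits at position [j + 1]; its sign (-1)^(j+1) meets (-1)^j from the bracket, leaving
     -1. *)
  rewrite (contractE _ j.+1) ?Phi_row // bracket_mon_omitS.
  rewrite (_ : (_ == _) = false) ?sub0r; last by lia.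
  rewrite exprS mulN1r scaleNr -signr_odd -[in X in _ *: X]signr_odd.
  by case: (odd j); rewrite ?scaleN1r ?mulN1r ?opprK // scale1r mul1r.
(* The exponent is now -(j+1), so the contracted index [j + 1] is positive and can only match the
   leading entry [n + 1]. *)
rewrite subr0; have [->|ne_jn] := eqVneq j n.
  rewrite (contractE _ 0%N) ?Phi_row // bracket_mon_omit0 scale1r.
  by rewrite (_ : (_ == _) = true) //; lia.
rewrite (_ : (_ == _) = false); last by lia.
by rewrite contract_out ?bracket0 // => k; rewrite Phi_row; case: k => [|k]; lia.
Qed.

(** Multiplication by 1/E(t) undoes the factor E(t) contained in [U_]. *)
Lemma sum_U_H n j :
  \sum_(k < j.+1) U_ (j - k) (u_ r n.+1%:Z) * H k = h_ r (n.+1 + j)%:Z.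
Proof.
transitivity (psmul H (psmul (E_ r) (fun i => h_ r (i%:Z + n.+1%:Z))) j).
  by apply: eq_bigr => k _; rewrite U_u mulrC.
by rewrite psmulA [psmul H _]psmulC psmulV ?E_0 // psmul1 addnC.
Qed.

End FixedRank.

(** * Coefficients of G h_n *)

Lemma GV_h (r : option nat) (r_ge1 : le_rank 1 r)
    (Gamma G : {linear Br r -> (int -> Br r)})
    (GammaP : is_GammaV Gamma) (GP : is_GV Gamma G) (n : nat) (m : int) :
  G (h_ r n%:Z) m = if m <= 0 then h_ r (n%:Z + m) else 0.
Proof.
rewrite -(Delta_row r_ge1) GP GammaP /lmul /zmul.
under eq_fsbigr do rewrite bracket_contract_row.
case: m => [[|j]|j].
(* z^0: every index [- k - 1] is negative, so only the pole z^(-n-1) contributes, at [k = n]. *)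
- rewrite lexx addr0 (@fsum_single _ n) => [|k ne_kn]; last first.
    rewrite (_ : (_ == _) = false); last by lia.
    by case E: (_ - 1) => [i|i]; [lia | rewrite subr0 mul0r].
  rewrite (_ : (_ == _) = true); last by lia.
  by case E: (_ - 1) => [i|i]; [lia | rewrite subr0 mul1r].
(* z^(j+1): the pole contributes h_(n+j+1) at [k = n + j + 1], the last term kept, and the terms in
   [U_] cancel it. *)
- rewrite /= (@fsum_ord _ (n + j).+2) => [|k le_k]; last first.
    rewrite (_ : (_ == _) = false); last by lia.
    by case E: (_ - 1) => [i|i]; [lia | rewrite subr0 mul0r].
  under eq_bigr do rewrite mulrBl.
  rewrite sumrB; apply/eqP; rewrite subr_eq0; apply/eqP.
  transitivity (h_ r (n.+1 + j)%:Z).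
    rewrite big_ord_recr big1 /= => [|[k lt_k] _ /=].
      by rewrite (_ : (_ == _) = true) ?mul1r ?add0r ?addSn //; lia.
    by rewrite (_ : (_ == _) = false) ?mul0r //; lia.
  (* Only [k <= j] gives a nonnegative index [j - k]; the other [n + 1] terms are zero. *)
  rewrite -sum_U_H (_ : (n + j).+2 = (j.+1 + n.+1)%N); last by lia.
  rewrite big_split_ord /= [X in _ + X]big1 => [|k _].
    rewrite addr0; apply: eq_bigr => -[k lt_k] _ /=.
    by rewrite (_ : _ - 1 = (j - k)%N%:Z) //; lia.
  by case E: (_ - 1) => [i|i]; [lia | rewrite mul0r].
(* z^(-j-1): the pole contributes only at [k = n - j - 1], which exists exactly when [j < n]. *)
have [le_jn|lt_nj] := leqP j.+1 n.
  rewrite (@fsum_single _ (n - j.+1)) => [|k ne_kn]; last first.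
    rewrite (_ : (_ == _) = false); last by lia.
    by case E: (_ - 1) => [i|i]; [lia | rewrite subr0 mul0r].
  rewrite (_ : (_ == _) = true) ?[in RHS](_ : _ + _ = (n - j.+1)%N%:Z); [|lia|lia].
  by case E: (_ - 1) => [i|i]; [lia | rewrite subr0 mul1r].
rewrite fsbig1 => [|k _].
  by case E: (_ + _) => //; lia.
rewrite (_ : (_ == _) = false); last by lia.
by case E: (_ - 1) => [i|i]; [lia | rewrite subr0 mul0r].
Qed.

Theorem lemma7p1 (r : option nat) (hr : le_rank 1%N r)
    (Gamma G : {linear Br r -> (int -> Br r)})
    (hGamma : is_GammaV Gamma) (hG : is_GV Gamma G) (n : nat) :
  G (h_ r n%:Z) =
    (fun m : int => \sum_(i \in [set: nat]) h_ r (n%:Z - i%:Z) * zpow r (- i%:Z) m)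
  /\
  G (h_ r n%:Z) =
    (fun m : int => \sum_(i < n) h_ r (n%:Z - i%:Z) * zpow r (- i%:Z) m
                    + zpow r (- n%:Z) m).
Proof.
have fsumE (m : int) : \sum_(i \in [set: nat]) h_ r (n%:Z - i%:Z) * zpow r (- i%:Z) m
    = if m <= 0 then h_ r (n%:Z + m) else 0.
  case: (leP m 0) => [m_le0|m_gt0].
    rewrite (@fsum_single _ `|m|%N) => [|k ne_k]; rewrite /zpow.
      by rewrite (_ : - _ = m) ?eqxx ?mulr1 //; lia.
    by rewrite (_ : (_ == _) = false) ?mulr0 //; lia.
  by rewrite fsbig1 // => k _; rewrite /zpow (_ : (_ == _) = false) ?mulr0 //; lia.
have GE : G (h_ r n%:Z) =
    (fun m => \sum_(i \in [set: nat]) h_ r (n%:Z - i%:Z) * zpow r (- i%:Z) m).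
  by apply/funext => m; rewrite fsumE (GV_h hr hGamma hG).
(* Terms beyond [i = n] vanish, as h has a negative index there; the term [i = n] has coefficient
   h_0 = 1. *)
split=> //; rewrite GE; apply/funext => m; rewrite (@fsum_ord _ n.+1) => [|k lt_nk].
  by rewrite big_ord_recr /= subrr mul1r.
by case E: (n%:Z - k%:Z) => [i|i]; [lia | rewrite mul0r].
Qed.
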